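(* Let $R$ be a ring. Then the following statements are equivalent: (1) Every $R$-module is a cl.Hilbert module. (2) Every $R$-module is a Hilbert module. (3) $\dim(R)=0$.
   Context: All rings are commutative with identity $1\neq 0$ and all modules are unital. For a submodule $P$ of an $R$-module $M$, $(P:M)=\{r\in R: rM\subseteq P\}$. A proper submodule $P$ of $M$ is prime if for all $a\in R$ and $m\in M$, $am\in P$ implies $m\in P$ or $a\in (P:M)$; it is classical prime if for all $a,b\in R$ and $m\in M$, $abm\in P$ implies $am\in P$ or $bm\in P$. An $R$-module $M$ is a Hilbert module if every prime submodule of $M$ is an intersection of maximal submodules of $M$; it is a cl.Hilbert module (classical Hilbert module) if every classical prime submodule of $M$ is an intersection of maximal submodules of $M$. $\dim(R)$ is the Krull dimension of $R$. *)

(* Defs.v *)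
From mathcomp Require Import all_boot all_order all_algebra.
From mathcomp Require Import boolp classical_sets.

Set Implicit Arguments.
Unset Strict Implicit.
Unset Printing Implicit Defensive.

Import GRing.Theory.
Local Open Scope classical_set_scope.
Local Open Scope ring_scope.

(* Submodules and ideals are Prop-valued sets, so that no decidability is
   built in; the boolean closure predicates of ssralg and ring_quotient apply
   to them through [mem], the classical membership test of classical_sets. *)

Section Submodules.
Variables (R : comNzRingType) (M : lmodType R).
Implicit Types (P N : set M).

Definition submodule P : Prop := GRing.submod_closed (mem P).

Definition proper_submodule P : Prop := submodule P /\ P != [set: M].

Definition colon P : set R := [set r | forall m : M, r *: m \in P].

Definition prime_submodule P : Prop :=
  proper_submodule P /\
  forall (a : R) (m : M), a *: m \in P -> m \in P \/ a \in colon P.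

Definition classical_prime_submodule P : Prop :=
  proper_submodule P /\
  forall (a b : R) (m : M),
    (a * b) *: m \in P -> a *: m \in P \/ b *: m \in P.

Definition maximal_submodule P : Prop :=
  proper_submodule P /\
  forall N, proper_submodule N -> P `<=` N -> N = P.

(* The family may be empty, with intersection M; a proper P is never that. *)
Definition intersection_of_maximal_submodules P : Prop :=
  exists2 F : set (set M),
    F `<=` maximal_submodule & P = \bigcap_(N in F) N.

End Submodules.

Definition Hilbert_module (R : comNzRingType) (M : lmodType R) : Prop :=
  forall P : set M, prime_submodule P -> intersection_of_maximal_submodules P.

Definition clHilbert_module (R : comNzRingType) (M : lmodType R) : Prop :=
  forall P : set M,
    classical_prime_submodule P -> intersection_of_maximal_submodules P.

Section KrullDimension.
Variable R : comNzRingType.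

(* [idealr_closed] includes properness (1 \notin p). *)
Definition prime_ideal (p : set R) : Prop :=
  idealr_closed (mem p) /\ prime_idealr_closed (mem p).

(* A strict chain p_0 < ... < p_n of n + 1 primes has length n. *)
Definition prime_chain (n : nat) (p : 'I_n.+1 -> set R) : Prop :=
  (forall i, prime_ideal (p i)) /\
  (forall i j : 'I_n.+1, (i < j)%N -> p i `<` p j).

(* The supremum of the lengths of chains of primes is the natural number d;
   a finite supremum of natural numbers is attained. *)
Definition has_krull_dim (d : nat) : Prop :=
  (exists p : 'I_d.+1 -> set R, prime_chain p) /\
  (forall (n : nat) (p : 'I_n.+1 -> set R), prime_chain p -> (n <= d)%N).

End KrullDimension.

(* Main.v *)
(** A prime ideal of [R] is the kernel of a ring morphism from [R] to a field
    [K].  As an [R]-module, [K] is divisible by every [a] outside [p], so the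
    zero submodule of [K] is prime, while a maximal submodule of [K] can only
    exist if [p] is maximal; hence (2) implies (3).

    If [R] is zero-dimensional and [P] is a classical prime submodule of [M],
    the ideals [(P : m)] with [m] outside [P] are prime, hence maximal, and
    comparing [m], [n] and [m + n] shows that they all coincide.  Thus [M / P]
    is a vector space over a residue field of [R], and there a subspace that is
    maximal among those avoiding a given vector is a hyperplane. *)

Require Import Defs.
From HB Require Import structures.
From mathcomp Require Import all_boot all_order all_algebra.
From mathcomp Require Import boolp classical_sets.

Set Implicit Arguments.
Unset Strict Implicit.
Unset Printing Implicit Defensive.

Import GRing.Theory.
Local Open Scope classical_set_scope.
Local Open Scope ring_scope.

(** * Submodules, and submodules avoiding a vector *)

Lemma submoduleP (R : comNzRingType) (M : lmodType R) (P : set M) :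
  submodule P <->
  P 0 /\ forall (a : R) (x y : M), P x -> P y -> P (a *: x + y).
Proof.
split=> -[P0 Plin]; split.
- exact: set_mem.
- by move=> a x y Px Py; apply/set_mem/Plin; apply/mem_set.
- exact: mem_set.
- by move=> a x y /set_mem Px /set_mem Py; apply/mem_set/Plin.
Qed.

Lemma submodule0 (R : comNzRingType) (M : lmodType R) (P : set M) :
  submodule P -> P 0.
Proof. by case/submoduleP. Qed.

Lemma submoduleZ (R : comNzRingType) (M : lmodType R) (P : set M) a x :
  submodule P -> P x -> P (a *: x).
Proof.
by case/submoduleP=> P0 Plin Px; rewrite -[_ *: _]addr0; apply: Plin.
Qed.

Lemma submoduleD (R : comNzRingType) (M : lmodType R) (P : set M) x y :
  submodule P -> P x -> P y -> P (x + y).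
Proof. by case/submoduleP=> _ Plin Px Py; rewrite -[x]scale1r; apply: Plin. Qed.

Lemma submoduleB (R : comNzRingType) (M : lmodType R) (P : set M) x y :
  submodule P -> P x -> P y -> P (x - y).
Proof.
move=> sP Px Py; rewrite -scaleN1r.
by apply: submoduleD => //; apply: submoduleZ.
Qed.

Lemma proper_submoduleP (R : comNzRingType) (M : lmodType R) (P : set M) x :
  submodule P -> ~ P x -> proper_submodule P.
Proof. by move=> sP Px; split=> //; apply/eqP=> PT; apply: Px; rewrite PT. Qed.

(** The submodule [N + R x], when [N] is a submodule. *)
Definition adjoin (R : comNzRingType) (M : lmodType R) (N : set M) (x : M) :
  set M := [set y | exists r : R, N (y - r *: x)].

Lemma submodule_adjoin (R : comNzRingType) (M : lmodType R) (N : set M) x :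
  submodule N -> submodule (adjoin N x).
Proof.
move=> sN; apply/submoduleP; split.
  by exists 0; rewrite scale0r subr0; apply: submodule0.
move=> a y z [r Nr] [s Ns]; exists (a * r + s).
rewrite scalerDl -scalerA opprD addrACA -scalerBr.
by apply: submoduleD => //; apply: submoduleZ.
Qed.

Lemma subset_adjoin (R : comNzRingType) (M : lmodType R) (N : set M) x :
  N `<=` adjoin N x.
Proof. by move=> y Ny; exists 0; rewrite scale0r subr0. Qed.

Lemma mem_adjoin (R : comNzRingType) (M : lmodType R) (N : set M) x :
  submodule N -> adjoin N x x.
Proof. by move=> sN; exists 1; rewrite scale1r subrr; apply: submodule0. Qed.

Lemma maximal_submodule_eqT (R : comNzRingType) (M : lmodType R)
    (N N' : set M) x :
  maximal_submodule N -> submodule N' -> N `<=` N' -> N' x -> ~ N x ->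
  forall y, N' y.
Proof.
move=> [_ maxN] sN' NN' N'x Nx y; apply: contrapT => N'y.
by apply: Nx; rewrite -(maxN N' (proper_submoduleP sN' N'y) NN').
Qed.

(** Zorn's lemma on the submodules that contain [P] and miss [m]: adjoining any further element to a
    maximal one captures [m]. Taking [m = 1] in [R] gives maximal ideals. *)
Lemma exists_maximal_avoiding (R : comNzRingType) (M : lmodType R)
    (P : set M) (m : M) :
  submodule P -> ~ P m ->
  exists N : set M, [/\ submodule N, P `<=` N, ~ N m &
    forall x, ~ N x -> adjoin N x m].
Proof.
move=> sP Pm.
pose good (N : set M) := [/\ submodule N, P `<=` N & ~ N m].
(* The empty set is admitted because it is the union of the empty chain. *)
have [F Fsub Ftot|N [Ngood Nmax]] :=
    @Zorn_bigcup M [set N | N = set0 \/ good N].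
  have [[N [FN Ngood]]|noN] := pselect (exists N, F N /\ good N); last first.
    left; rewrite -subset0 => x [N FN Nx]; case: (Fsub N FN) => [N0|gN].
      by rewrite N0 in Nx.
    by case: noN; exists N.
  right; have [sN PN Nm] := Ngood; split.
  - apply/submoduleP; split; first by exists N => //; apply: submodule0.
    have good_of N1 x : F N1 -> N1 x -> submodule N1.
      by move=> FN1 N1x; case: (Fsub N1 FN1) => [N0|[]//]; rewrite N0 in N1x.
    move=> a x y [N1 F1 N1x] [N2 F2 N2y].
    have [N12|N21] := Ftot N1 N2 F1 F2.
    + have sN2 := good_of N2 y F2 N2y; exists N2 => //.
      by apply: submoduleD => //; apply: submoduleZ => //; apply: N12.
    + have sN1 := good_of N1 x F1 N1x; exists N1 => //.
      by apply: submoduleD => //; [apply: submoduleZ | apply: N21].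
  - by move=> x Px; exists N; [exact: FN | exact: PN].
  - move=> [N1 F1 N1m]; case: (Fsub N1 F1) => [N0|[_ _ /(_ N1m)//]].
    by rewrite N0 in N1m.
case: Ngood => [N0|[sN PN Nm]].
  (* The empty set is not maximal: [P] contains [0], so it is strictly larger. *)
  case: (Nmax P); last by right; split.
  by rewrite N0; split=> [//|/(_ 0 (submodule0 sP))].
exists N; split => // x Nx; apply: contrapT => Nxm.
apply: (Nmax (adjoin N x)); last first.
  right; split=> //; first exact: submodule_adjoin.
  exact: subset_trans (subset_adjoin x).
split; first exact: subset_adjoin.
by move=> /(_ x (mem_adjoin x sN)).
Qed.

(** * Prime ideals, maximal ideals and residue domains *)

Lemma prime_idealP (R : comNzRingType) (p : set R) :
  prime_ideal p <->
  [/\ submodule (p : set R^o), ~ p 1 &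
      forall u v : R, p (u * v) -> p u \/ p v].
Proof.
split=> [[[p0 p1 plin] pM]|[/submoduleP [p0 plin] p1 pM]].
  split.
  - by split=> // a x y; apply: plin.
  - by move=> /mem_set; apply/negP.
  - by move=> u v /mem_set/pM/orP[]/set_mem; [left|right].
split; first split.
- exact: mem_set.
- by apply/negP => /set_mem.
- by move=> a x y /set_mem px /set_mem py; apply/mem_set/(plin a x y).
- by move=> u v /set_mem/pM[] H; apply/orP; [left|right]; apply/mem_set.
Qed.

(** For an ideal [q], every nonzero class of [R / q] is a unit; for a prime [q] this is maximality,
    stated on elements. *)
Definition invertible_outside (R : comNzRingType) (q : set R) : Prop :=
  forall a : R, ~ q a -> exists s : R, q (1 - s * a).

(** An ideal maximal among those missing [1] captures [1] once any outside [u] is adjoined, so [u]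
    is invertible modulo it; primality follows by cancelling [u]. *)
Lemma exists_maximal_ideal (R : comNzRingType) (I : set R) :
  submodule (I : set R^o) -> ~ I 1 ->
  exists q : set R, [/\ prime_ideal q, I `<=` q & invertible_outside q].
Proof.
move=> sI I1.
have [q [sq Iq q1 qmax]] := @exists_maximal_avoiding R R^o I 1 sI I1.
have qinv : invertible_outside q by move=> a /qmax [s qs]; exists s.
exists q; split => //; apply/prime_idealP; split=> // u v quv.
have [qu|/qinv [s qs]] := pselect (q u); [by left | right].
have -> : v = v * (1 - s * u) + s * (u * v).
  by rewrite mulrBr mulr1 mulrC -mulrA subrK.
apply: (submoduleD (P := q : set R^o)) => //;
  exact: (submoduleZ (P := q : set R^o)).
Qed.

(** [K] is the fraction field. Its construction asks for an [idomainType], so inverses in [Q] are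
    first chosen classically. *)
Lemma domain_field_embedding (Q : comNzRingType) :
  GRing.integral_domain_axiom Q ->
  exists (K : fieldType) (f : {rmorphism Q -> K}), injective f.
Proof.
move=> Qdom.
pose unit : {pred Q} := fun x => `[< exists y : Q, y * x = 1 >].
(* Nonunits are sent to themselves, as the unit ring interface demands. *)
pose inv (x : Q) : Q :=
  if pselect (exists y : Q, y * x = 1) is left e then projT1 (cid e) else x.
have mulVx : {in unit, left_inverse 1 inv *%R}.
  move=> x /asboolP ux; rewrite /inv; case: pselect => // e.
  exact: (projT2 (cid e)).
have unitPl : forall x y : Q, y * x = 1 -> unit x.
  by move=> x y yx; apply/asboolP; exists y.
have inv_out : {in [predC unit], inv =1 id}.
  by move=> x /asboolPn ux; rewrite /inv; case: pselect.
pose U : comUnitRingType := HB.pack (GRing.ComNzRing.sort Q)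
  (GRing.ComNzRing_hasMulInverse.Build Q mulVx unitPl inv_out).
pose D : idomainType := HB.pack (GRing.ComUnitRing.sort U)
  (GRing.ComUnitRing_isIntegral.Build U Qdom).
exists {fraction D}, (@FracField.tofrac D : {rmorphism D -> _}) => x y /eqP.
by rewrite tofrac_eq => /eqP.
Qed.

Lemma prime_ideal_ker_field (R : comNzRingType) (p : set R) :
  prime_ideal p ->
  exists (K : fieldType) (f : {rmorphism R -> K}),
    forall a : R, f a = 0 <-> p a.
Proof.
move=> [pideal pprime].
pose I : prime_idealr R := HB.pack (mem p : R -> bool)
  (isIdealr.Build R (mem p) pideal)
  (isPrimeIdealrClosed.Build R (mem p) pprime).
have [K [f finj]] := domain_field_embedding (@Quotient.rquot_IdomainAxiom R I).
exists K, (f \o \pi_{ideal_quot I}%qT : {rmorphism R -> K}) => a /=.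
rewrite -(rmorph0 f); split=> [/finj/eqP|pa].
  by rewrite piE Quotient.equivE subr0 => /set_mem.
by congr (f _); apply/eqP; rewrite piE Quotient.equivE subr0; apply/mem_set.
Qed.

(** * A field as a module over the ring *)

Section RestrictionOfScalars.
Variables (R : comNzRingType) (K : fieldType) (f : {rmorphism R -> K}).

(* The unused argument selects the [R]-module structure put on [K]. *)
Definition restrict_scalars (_ : {rmorphism R -> K}) : Type := K.
HB.instance Definition _ := GRing.Zmodule.on (restrict_scalars f).

Let scale (r : R) (x : restrict_scalars f) : restrict_scalars f :=
  f r * (x : K).

Let scaleA a b v : scale a (scale b v) = scale (a * b) v.
Proof. by rewrite /scale rmorphM mulrA. Qed.

Let scale1 : left_id 1 scale.
Proof. by move=> v; rewrite /scale rmorph1 mul1r. Qed.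

Let scaleDr : right_distributive scale +%R.
Proof. by move=> a u v; rewrite /scale mulrDr. Qed.

Let scaleDl v : {morph scale^~ v : a b / a + b}.
Proof. by move=> a b; rewrite /scale rmorphD mulrDl. Qed.

HB.instance Definition _ := GRing.Zmodule_isLmodule.Build R
  (restrict_scalars f) scaleA scale1 scaleDr scaleDl.

Lemma restrict_scaleE (r : R) (x : restrict_scalars f) :
  r *: x = f r * (x : K).
Proof. by []. Qed.

Lemma restrict_scalars_prime :
  prime_submodule ([set 0] : set (restrict_scalars f)).
Proof.
split.
  apply: (@proper_submoduleP R (restrict_scalars f) [set 0] (1 : K)).
    apply/submoduleP; split=> // a x y -> ->.
    by rewrite scaler0 addr0.
  by move=> /eqP; apply/negP/oner_neq0.
move=> a m /set_mem/eqP; rewrite restrict_scaleE mulf_eq0 => /orP[]/eqP fa0.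
  right; apply/mem_set => x; apply/mem_set.
  by rewrite restrict_scaleE fa0 mul0r.
by left; apply/mem_set.
Qed.

(* If [x] avoids [N], maximality gives [x / f a = n + s x] with [n] in [N], so
   [b = 1 - s a] maps [x] into [N].  Then [{y | b y in N}] is all of [K], which
   is absurd when [f b] is invertible. *)
Lemma restrict_scalars_maximal (N : set (restrict_scalars f)) (a : R) :
  maximal_submodule N -> f a != 0 -> exists s : R, f (1 - s * a) = 0.
Proof.
move=> maxN fa; have [[sN NT] _] := maxN.
have [x Nx] : exists x, ~ N x.
  apply: contrapT => noN; case/eqP: NT; apply/seteqP; split=> // x _.
  by apply: contrapT => Nx; apply: noN; exists x.
have [r Nr] := maximal_submodule_eqT maxN (submodule_adjoin x sN)
  (@subset_adjoin _ _ N x) (mem_adjoin x sN) Nx ((f a)^-1 * (x : K)).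
exists r; apply: contrapT => /eqP fb; set b := 1 - r * a in fb.
have Nbx : N (b *: x).
  have := submoduleZ a sN Nr; congr N.
  rewrite scalerBr scalerA !restrict_scaleE mulrA divff // mul1r.
  by rewrite (mulrC a) /b rmorphB rmorph1 mulrBl mul1r.
pose N' := [set y | N (b *: y)].
have sN' : submodule N'.
  apply/submoduleP; split; first by rewrite /N' /= scaler0; apply: submodule0.
  move=> c y z Ny Nz; rewrite /N' /= scalerDr scalerA mulrC -scalerA.
  by apply: submoduleD => //; apply: submoduleZ.
have NN' : N `<=` N' by move=> y; apply: submoduleZ.
have := maximal_submodule_eqT maxN sN' NN' Nbx Nx ((f b)^-1 * (x : K)).
by rewrite /N' /= restrict_scaleE mulVKf.
Qed.

End RestrictionOfScalars.

(** * Hilbert modules and dimension zero *)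

Lemma Hilbert_prime_invertible (R : comNzRingType) (p : set R) :
  (forall M : lmodType R, Hilbert_module M) ->
  prime_ideal p -> invertible_outside p.
Proof.
move=> HR /prime_ideal_ker_field [K [f kerf]] a pa.
have [F Fmax F0] := HR _ _ (restrict_scalars_prime f).
(* An empty family would have intersection [K], but the zero submodule misses [1]. *)
have [N FN] : exists N, F N.
  apply: contrapT => noN.
  have : [set 0] (1 : restrict_scalars f).
    by rewrite F0 => N FN; case: noN; exists N.
  by move=> /eqP; apply/negP/oner_neq0.
have [|s /kerf ps] := restrict_scalars_maximal (a := a) (Fmax N FN).
  by apply/eqP => /kerf.
by exists s.
Qed.

Lemma invertible_outside_max (R : comNzRingType) (p q : set R) :
  prime_ideal q -> invertible_outside p -> p `<=` q -> q `<=` p.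
Proof.
move=> /prime_idealP[sq q1 _] pinv pq a qa; apply: contrapT => /pinv[s ps].
apply: q1; rewrite -(subrK (s * a) 1).
apply: (submoduleD (P := q : set R^o)) => //; first exact: pq.
exact: (submoduleZ (P := q : set R^o)).
Qed.

Lemma krull_dim0P (R : comNzRingType) :
  has_krull_dim R 0 <->
  forall p : set R, prime_ideal p -> invertible_outside p.
Proof.
split=> [[_ dimR] p pp|pinv].
  have [sp p1 _] := (prime_idealP p).1 pp.
  have [q [pq sub_pq qinv]] := exists_maximal_ideal sp p1.
  have [qp|nqp] := pselect (q `<=` p).
    by have -> : p = q by apply/seteqP.
  (* A strictly larger [q] would give a chain of length 1. *)
  have : prime_chain (fun i : 'I_2 => if i == 0 then p else q).
    split=> [i|i j ij]; first by case: ifP.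
    have -> : i = 0 by apply/val_inj; case: i j ij => [[|[]]//= ?] [[|[]]//= ?].
    have -> : j = 1 by apply/val_inj; case: i j ij => [[|[]]//= ?] [[|[]]//= ?].
    by [].
  by move/dimR.
(* A maximal ideal gives a chain of length 0. In a longer chain the first prime would be maximal,
   yet strictly below the last. *)
split.
  have [||q [pq _ _]] := @exists_maximal_ideal R [set 0].
  - by apply/submoduleP; split=> // a x y -> ->; rewrite scaler0 addr0.
  - by move=> /eqP; apply/negP/oner_neq0.
  - by exists (fun=> q); split=> // -[[]// ?] [[]// ?].
case=> // n p [pp pstrict].
have [sub nsub] := pstrict ord0 ord_max isT.
by case: nsub; apply: invertible_outside_max (pinv _ (pp _)) sub.
Qed.

(** * Classical prime submodules in dimension zero *)

Lemma classical_prime_residual (R : comNzRingType) (M : lmodType R)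
    (P : set M) (m : M) :
  classical_prime_submodule P -> ~ P m -> prime_ideal [set r : R | P (r *: m)].
Proof.
move=> [[sP _] cP] Pm; apply/prime_idealP; split=> /=.
- apply/submoduleP; split=> /=; first by rewrite scale0r; apply: submodule0.
  move=> a x y Px Py; rewrite scalerDl -scalerA.
  by apply: submoduleD => //; apply: submoduleZ.
- by rewrite scale1r.
- by move=> u v /mem_set/cP[]/set_mem; [left|right].
Qed.

Lemma residual_constant (R : comNzRingType) (M : lmodType R) (P : set M)
    (m n : M) (a : R) :
  has_krull_dim R 0 -> classical_prime_submodule P -> ~ P m -> ~ P n ->
  P (a *: m) -> P (a *: n).
Proof.
move=> /krull_dim0P dimR cP Pm Pn Pam; have [[sP _] _] := cP.
pose res x := [set r : R | P (r *: x)].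
have pres x : ~ P x -> prime_ideal (res x) :=
  @classical_prime_residual R M P x cP.
have [Pmn|Pmn] := pselect (P (m + n)).
  (* Here [n] is congruent to [- m] modulo [P]. *)
  rewrite -[n](addKr m) scalerDr scalerN addrC.
  by apply: submoduleB => //; apply: submoduleZ.
have [resm|/existsNP[b]] := pselect (res m `<=` res (m + n)).
  have Pamn : P (a *: (m + n)) by exact: resm.
  by rewrite -[n](addKr m) scalerDr scalerN addrC; apply: submoduleB.
move=> /not_implyP[Pbm Pbmn].
(* For [c] in [res n], [b * c] sends both [m] and [n] into [P]. As [b] is outside the prime
   [res (m + n)], [c] sends [m + n], and with it [m], into [P]. Maximality of [res n] then reverses
   the inclusion. *)
have resnm : res n `<=` res m.
  move=> c Pcn; have /prime_idealP[_ _ pmn] := pres _ Pmn.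
  have [|//|Pcmn] := pmn b c; rewrite /res /=.
    rewrite scalerDr; apply: submoduleD => //; last first.
      by rewrite -scalerA; apply: submoduleZ.
    by rewrite mulrC -scalerA; apply: submoduleZ.
  by rewrite -[m](addrK n) scalerBr; apply: submoduleB.
exact: (invertible_outside_max (pres _ Pm) (dimR _ (pres _ Pn)) resnm).
Qed.

Lemma dim0_clHilbert (R : comNzRingType) (M : lmodType R) :
  has_krull_dim R 0 -> clHilbert_module M.
Proof.
move=> dimR P cP; have [[sP _] _] := cP.
exists [set N | maximal_submodule N /\ P `<=` N]; first by move=> N [].
apply/seteqP; split=> [m Pm N [_]|m Fm]; first exact.
apply: contrapT => Pm.
(* [N] is a maximal submodule: a strictly larger [N'] contains [m], and an [n] missing from it is
   shown to lie in it. *)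
have [N [sN PN Nm Nadj]] := exists_maximal_avoiding sP Pm.
apply: (Nm); apply: Fm; split=> //; split; first exact: proper_submoduleP Nm.
move=> N' [sN' N'T] NN'; apply/seteqP; split=> // x N'x.
apply: contrapT => Nx; case/eqP: N'T; apply/seteqP; split=> // n _.
have N'm : N' m.
  have [r Nr] := Nadj x Nx; rewrite -(subrK (r *: x) m).
  by apply: submoduleD; [|exact: NN'|exact: submoduleZ].
apply: contrapT => N'n; have Nn : ~ N n by move=> /NN'.
have [r Nr] := Nadj n Nn.
(* If [r] sent [m] into [P], it would send [n] into [P], forcing [m] into [N]. *)
have [/(residual_constant dimR cP)rP|Prm] := pselect (P (r *: m)).
  apply: Nm; rewrite -(subrK (r *: n) m).
  by apply: submoduleD => //; apply: (PN); apply: rP => // /PN.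
have resm := classical_prime_residual cP Pm.
(* Now [s] inverts [r] modulo the residual of [m], hence modulo that of [n]: [n] agrees with
   [(s * r) *: n] modulo [P], and [r *: n] lies in [N'] because [m] does. *)
have [s Ps] := (krull_dim0P R).1 dimR _ resm r Prm.
apply: N'n; rewrite -(subrK ((s * r) *: n) n); apply: submoduleD => //.
  rewrite -{1}[n]scale1r -scalerBl; apply/NN'/PN.
  by apply: (residual_constant dimR cP) Ps => // /PN.
rewrite -scalerA -(subKr m (r *: n)); apply: submoduleZ => //.
by apply: submoduleB => //; apply: NN'.
Qed.

Theorem theorem2p18 (R : comNzRingType) :
  ((forall M : lmodType R, clHilbert_module M) <->
   (forall M : lmodType R, Hilbert_module M)) /\
  ((forall M : lmodType R, Hilbert_module M) <-> has_krull_dim R 0).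
Proof.
have cl_H : (forall M : lmodType R, clHilbert_module M) ->
    forall M : lmodType R, Hilbert_module M.
  (* A prime submodule is classical prime: apply primality to [a] and [b *: m]. *)
  move=> clR M P [pP prP]; apply: clR; split=> // a b m.
  rewrite -scalerA => /prP[|/set_mem]; first by right.
  by move=> aM; left; apply: aM.
have H_dim : (forall M : lmodType R, Hilbert_module M) -> has_krull_dim R 0.
  by move=> HR; apply/krull_dim0P => p; apply: Hilbert_prime_invertible.
have dim_cl : has_krull_dim R 0 -> forall M : lmodType R, clHilbert_module M.
  by move=> dimR M; apply: dim0_clHilbert.
by split; split; auto.
Qed.
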